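(* For all positive integers $c\geq 3$, $r$, and $n$ there exists a finite graph $G=(V,E)$ such that $\chi_r^{\mathrm{loc}}(G)\leq c$, $\chi(G)\geq n(c-1)+1$, and $$|V|=\frac{(2rc+1)^n-1}{2r}.$$
   Context: Graphs are simple (no loops or multiple edges). $\chi(G)$ denotes the chromatic number of $G$. For vertices $u,v$ of $G$, $d_G(u,v)$ is the graph distance. For a positive integer $r$ and a vertex $v$, the ball of radius $r$ centered at $v$ is $U_r(v,G)=\{u\in V: d_G(u,v)\leq r\}$. The $r$-local chromatic number $\chi_r^{\mathrm{loc}}(G)$ is the maximum, over all vertices $v$, of the chromatic number of the subgraph of $G$ induced on the ball $U_r(v,G)$. *)

(* Defs.v *)
From mathcomp Require Import all_boot all_order all_algebra.
Set Implicit Arguments.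
Unset Strict Implicit.
Unset Printing Implicit Defensive.

Record sgraph := SGraph {
  vertex :> finType;
  adj : rel vertex;
  adj_sym : symmetric adj;
  adj_irrefl : irreflexive adj }.

Section Induced.
Variables (G : sgraph) (S : {set G}).

Definition induced_adj : rel {x : G | x \in S} :=
  fun x y => adj (val x) (val y).

Lemma induced_adj_sym : symmetric induced_adj.
Proof. by move=> x y; exact: adj_sym. Qed.

Lemma induced_adj_irrefl : irreflexive induced_adj.
Proof. by move=> x; exact: adj_irrefl. Qed.

Definition induced : sgraph := SGraph induced_adj_sym induced_adj_irrefl.
End Induced.

Section Chromatic.
Variable G : sgraph.

Definition proper_coloring (k : nat) (f : {ffun G -> 'I_k}) : bool :=
  [forall x : G, forall y : G, adj x y ==> (f x != f y)].

Definition colorable (k : nat) : bool :=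
  [exists f : {ffun G -> 'I_k}, proper_coloring f].

Lemma ex_colorable : exists k, colorable k.
Proof.
exists #|G|; apply/existsP; exists [ffun x => enum_rank x].
apply/forallP=> x; apply/forallP=> y; apply/implyP=> xy.
rewrite !ffunE (inj_eq enum_rank_inj).
by apply: contraTneq xy => ->; rewrite adj_irrefl.
Qed.

Definition chromatic_number : nat := ex_minn ex_colorable.
End Chromatic.

Section Distance.
Variable G : sgraph.

Definition walk_of_length (u v : G) (k : nat) : bool :=
  [exists p : k.-tuple G, path (@adj G) u p && (last u p == v)].

Lemma connect_walk (u v : G) :
  connect (@adj G) u v -> exists k, walk_of_length u v k.
Proof.
case/connectP=> p up ->; exists (size p).
by apply/existsP; exists (in_tuple p); rewrite up eqxx.
Qed.

(* [None] is the infinite distance between distinct connected components. *)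
Definition dist (u v : G) : option nat :=
  match @idP (connect (@adj G) u v) with
  | ReflectT uv => Some (ex_minn (connect_walk uv))
  | ReflectF _ => None
  end.

Definition ball (r : nat) (v : G) : {set G} :=
  [set u | if dist u v is Some d then d <= r else false].
End Distance.

Definition local_chromatic_number (r : nat) (G : sgraph) : nat :=
  \max_(v : G) chromatic_number (induced (ball r v)).

(* Main.v *)
(** The graph is built by iterating a "tower" over a graph [G], starting from
    the complete graph on [c] vertices.  Level [0] of the tower is [G], the
    levels [1 .. 2r] are copies of [G x K_c], and level [2r + 1] is [K_c];
    vertices at consecutive or equal levels are adjacent when all their defined
    projections to [G] and to [K_c] are.  A ball of radius [r] misses level
    [2r + 1], and then projects to a ball of [G], or misses level [0], and then
    projects to [K_c]; so [c] colours always suffice locally.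

    The lower bound is Fan's lemma modulo 2 in the box complex, whose vertices
    are signed vertices of the graph and whose simplices are the sets in which
    every positive vertex is adjacent to every negative one.  A proper colouring
    labels the signed vertices, and the number of simplices of an invariant
    cycle on which the signs alternate along increasing colours is preserved
    modulo 2 when the cycle is replaced by the suspension obtained by
    contracting it to a vertex.  In the tower, an invariant cycle of [G] can be
    suspended [c - 1] times, at all the vertices of [K_c] except one. *)
Require Import Defs.
From mathcomp Require Import all_boot all_order all_algebra.
From mathcomp Require Import zify.
Set Implicit Arguments.
Unset Strict Implicit.
Unset Printing Implicit Defensive.
Import GRing.Theory Num.Theory.

(** * Chains, prisms and cones modulo 2 *)

(* Chains modulo 2 are lists of ordered simplices, compared only through their
   values [ev] on all cochains; [cobd] is the coboundary. *)
Definition ev (T : Type) (c : seq (seq T)) (phi : seq T -> bool) : bool :=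
  \big[addb/false]_(s <- c) phi s.

Fixpoint cobd (T : Type) (phi : seq T -> bool) (s : seq T) : bool :=
  if s is x :: s' then phi s' (+) cobd (fun t => phi (x :: t)) s' else false.

(** The usual prism operator: the chain of all [f x0, ..., f xi, g xi, ..., g xn]. *)
Fixpoint prism (T U : Type) (f g : T -> U) (s : seq T) : seq (seq U) :=
  if s is x :: s' then
    (f x :: g x :: map g s') :: map (cons (f x)) (prism f g s')
  else [::].

(** The complex is augmented: a point has the empty simplex as boundary, so [[:: [::]]] is a
    cycle. *)
Definition mod2_cycle (T : Type) (c : seq (seq T)) : Prop :=
  forall phi, ev c (cobd phi) = false.

Lemma ev_nil T (phi : seq T -> bool) : ev [::] phi = false.
Proof. exact: big_nil. Qed.

Lemma ev_cons T s c (phi : seq T -> bool) : ev (s :: c) phi = phi s (+) ev c phi.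
Proof. exact: big_cons. Qed.

Lemma ev_cat T c c' (phi : seq T -> bool) : ev (c ++ c') phi = ev c phi (+) ev c' phi.
Proof. exact: big_cat. Qed.

Lemma ev_map T U (h : seq T -> seq U) c phi : ev (map h c) phi = ev c (phi \o h).
Proof. exact: big_map. Qed.

Lemma eq_ev T (phi psi : seq T -> bool) c : phi =1 psi -> ev c phi = ev c psi.
Proof. by move=> e; apply: eq_bigr => s _; exact: e. Qed.

Lemma eq_in_ev (T : eqType) (phi psi : seq T -> bool) c :
  {in c, phi =1 psi} -> ev c phi = ev c psi.
Proof. exact: eq_big_seq. Qed.

Lemma ev_add T (phi psi : seq T -> bool) c :
  ev c (fun s => phi s (+) psi s) = ev c phi (+) ev c psi.
Proof. exact: big_split. Qed.

Lemma ev_flatten T U (h : seq T -> seq (seq U)) c phi :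
  ev (flatten (map h c)) phi = ev c (fun s => ev (h s) phi).
Proof.
elim: c => [|s c IH] /=; first by rewrite !ev_nil.
by rewrite ev_cat ev_cons IH.
Qed.

Lemma eq_cobd T (phi psi : seq T -> bool) : phi =1 psi -> cobd phi =1 cobd psi.
Proof.
move=> e s; elim: s phi psi e => //= x s IH phi psi e.
by rewrite e; congr (_ (+) _); apply: IH => t; rewrite e.
Qed.

Lemma cobd_add T (phi psi : seq T -> bool) s :
  cobd (fun t => phi t (+) psi t) s = cobd phi s (+) cobd psi s.
Proof.
elim: s phi psi => //= x s IH phi psi.
by rewrite IH addbACA.
Qed.

Lemma cobd_map T U (f : T -> U) phi s : cobd phi (map f s) = cobd (phi \o map f) s.
Proof. by elim: s phi => //= x s IH phi; rewrite IH. Qed.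

(** Dual form of the homotopy formula: the boundary of the prism plus the prism of the boundary is
    the sum of the two ends. *)
Lemma ev_prism T U (f g : T -> U) phi s :
  ev (prism f g s) (cobd phi) =
  phi (map g s) (+) phi (map f s) (+) cobd (fun t => ev (prism f g t) phi) s.
Proof.
elim: s phi => [|x s IH] phi /=; first by rewrite ev_nil addbb.
rewrite ev_cons ev_map /=.
have -> : ev (prism f g s) (cobd phi \o cons (f x)) =
    ev (prism f g s) phi (+) ev (prism f g s) (cobd (phi \o cons (f x))).
  by rewrite -ev_add; apply: eq_ev => t /=.
rewrite IH /=.
have -> : cobd (fun t => ev ((f x :: g x :: map g t) ::
            map (cons (f x)) (prism f g t)) phi) s =
    cobd (fun t => phi (f x :: g x :: t)) (map g s) (+)
    cobd (fun t => ev (prism f g t) (phi \o cons (f x))) s.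
  rewrite cobd_map -cobd_add; apply: eq_cobd => t.
  by rewrite ev_cons ev_map.
(* The term [phi (f x :: map g s)], named [b], occurs twice and cancels. *)
move: (phi (g x :: _)) (phi (f x :: map g s)) (phi (f x :: map f s)) => a b d.
move: (ev _ phi) (cobd _ (map g s)) (cobd _ s) => e k l.
by case: a b d e k l => [] [] [] [] [] [].
Qed.

Lemma ev_cone T (w : T) c phi : mod2_cycle c -> ev (map (cons w) c) (cobd phi) = ev c phi.
Proof.
move=> cc; rewrite ev_map (@eq_ev _ _ (fun s => phi s (+) cobd (phi \o cons w) s)) //.
by rewrite ev_add cc addbF.
Qed.

Lemma ev_homotopy T U (f g : T -> U) c phi : mod2_cycle c ->
  ev (flatten (map (prism f g) c)) (cobd phi) =
  ev c (phi \o map g) (+) ev c (phi \o map f).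
Proof.
move=> cc; rewrite ev_flatten (eq_ev _ (ev_prism f g phi)) !ev_add.
by rewrite (cc (fun t => ev (prism f g t) phi)) addbF.
Qed.

Lemma mod2_cycle_map T U (f : T -> U) c : mod2_cycle c -> mod2_cycle (map (map f) c).
Proof. by move=> cc phi; rewrite ev_map (eq_ev _ (cobd_map f phi)); apply: cc. Qed.

Lemma prismP (T U : eqType) (f g : T -> U) s t : t \in prism f g s ->
  size t = (size s).+1 /\ {subset t <= map f s ++ map g s}.
Proof.
elim: s t => //= x s IH t; rewrite inE => /orP[/eqP -> | /mapP[t' /IH[sz sub] ->]].
  rewrite /= size_map; split=> // y; rewrite !(inE, mem_cat).
  by case/or3P=> ->; rewrite ?orbT.
rewrite /= sz; split=> // y; rewrite !(inE, mem_cat).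
case/orP=> [->//|/sub]; rewrite mem_cat.
by case/orP=> ->; rewrite ?orbT.
Qed.

(** * Alternating sign patterns *)

Fixpoint alts (b : bool) (s : seq bool) : bool :=
  if s is x :: s' then (x == b) && alts (~~ b) s' else true.

(** A non-alternating sequence can only become alternating by losing either of two equal neighbours,
    so in an even number of ways. A nonempty alternating one yields a pattern starting with [b] in
    one way: by losing its last entry if it starts with [b], its first otherwise. *)
Lemma cobd_alts b s : cobd (alts b) s = alts b s (+) alts (~~ b) s.
Proof.
elim: s b => //= x s IH b.
have cobd0 (t : seq bool) : cobd xpred0 t = false by elim: t.
case: x b => [] []; rewrite ?cobd0 ?addbF //=.
- by rewrite (IH false) addbC addbK.
- by rewrite (IH true) addbC addbK.
Qed.

Lemma alts_map_negb b s : alts b (map negb s) = alts (~~ b) s.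
Proof. by elim: s b => //= x s IH b; rewrite IH; case: x b => [] []. Qed.

Lemma cobd_rem (T : eqType) (phi : seq T -> bool) s :
  (forall t t', perm_eq t t' -> phi t = phi t') ->
  cobd phi s = \big[addb/false]_(x <- s) phi (rem x s).
Proof.
elim: s phi => [|x s IH] phi inv; first by rewrite big_nil.
rewrite big_cons /= eqxx IH => [|t t' tt']; last by apply: inv; rewrite perm_cons.
congr (_ (+) _); apply: eq_big_seq => y ys; apply: inv.
by case: eqVneq => // ->; rewrite perm_sym perm_to_rem.
Qed.

(** Lets the labels be sorted before the coboundary of [alt] is computed. *)
Lemma perm_cobd (T : eqType) (phi : seq T -> bool) s s' :
  (forall t t', perm_eq t t' -> phi t = phi t') ->
  perm_eq s s' -> cobd phi s = cobd phi s'.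
Proof.
move=> inv ss'; rewrite !cobd_rem // (perm_big _ ss'); apply: eq_big_seq => x xs'.
apply: inv; rewrite -(perm_cons x) -(permPr (perm_to_rem xs')).
by rewrite (perm_trans _ ss') // perm_sym perm_to_rem // (perm_mem ss').
Qed.

Lemma eq_cobd_subseq (T : eqType) (phi psi : seq T -> bool) s :
  (forall t, subseq t s -> phi t = psi t) -> cobd phi s = cobd psi s.
Proof.
elim: s phi psi => //= x s IH phi psi e; rewrite (e s (subseq_cons s x)).
by congr (_ (+) _); apply: IH => t ts; apply: e; rewrite /= eqxx.
Qed.

(* A colour [c] with sign [b] is encoded as the number [2 c + b]. *)
Definition alt (s : seq nat) : bool := alts true (map odd (sort leq s)).

Definition opp_label (a : nat) : nat := a./2.*2 + ~~ odd a.

Lemma alt_perm s t : perm_eq s t -> alt s = alt t.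
Proof.
move=> st; rewrite /alt; have /perm_sortP-> // := st.
- exact: leq_total.
- exact: leq_trans.
- exact: anti_leq.
Qed.

(** Labels of the same colour coincide, so reversing all signs keeps the labels in order and only
    negates the parities. *)
Lemma alt_opp s : {in s &, injective half} ->
  alt (map opp_label s) = alts false (map odd (sort leq s)).
Proof.
move=> inj; rewrite /alt.
have -> : sort leq (map opp_label s) = map opp_label (sort leq s).
  apply: (sorted_eq leq_trans anti_leq); first exact: sort_sorted leq_total _.
    apply: (homo_sorted_in (P := [in s]) (e := leq)).
    - move=> a b sa sb ab; rewrite /opp_label.
      have [e|ne] := eqVneq a./2 b./2; first by rewrite (inj a b).
      by lia.
    - by apply/allP => a; rewrite mem_sort.
    - exact: sort_sorted leq_total _.
  by rewrite perm_sort perm_map // perm_sym perm_sort.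
rewrite -(alts_map_negb true) -!map_comp; congr (alts _ _); apply: eq_map => a /=.
by rewrite /opp_label oddD odd_double; case: (odd a).
Qed.

Lemma cobd_alt s : {in s &, injective half} ->
  cobd alt s = alt s (+) alt (map opp_label s).
Proof.
move=> inj; rewrite alt_opp // (@perm_cobd _ _ _ (sort leq s) alt_perm).
  rewrite {1}/alt.
  rewrite (@eq_cobd_subseq _ alt (alts true \o map odd)) => [|t ts].
    by rewrite -cobd_map cobd_alts.
  rewrite /alt sorted_sort //; first exact: leq_trans.
  exact: (subseq_sorted leq_trans ts) (sort_sorted leq_total _).
by rewrite perm_sym perm_sort.
Qed.

Lemma alts_ltn e a l :
  odd a = e -> alts (~~ e) (map odd l) -> path leq a l -> path ltn a l.
Proof.
elim: l a e => //= b l IH a e ea /andP[/eqP eb al] /andP[ab pl].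
rewrite (IH b (~~ e)) // andbT ltn_neqAle ab andbT.
by apply/eqP => eab; rewrite -eab ea in eb; case: (e) eb.
Qed.

(** Alternation makes the sorted labels strictly increasing, so their colours are distinct. *)
Lemma alt_size s k : {in s &, injective half} ->
  {in s, forall a, a./2 < k} -> alt s -> size s <= k.
Proof.
move=> inj bnd als.
have us : uniq s.
  rewrite -(sort_uniq leq); apply: (sorted_uniq ltn_trans ltnn).
  have := sort_sorted leq_total s; move: als; rewrite /alt.
  by case: (sort leq s) => //= a l /andP[/eqP]; apply: alts_ltn.
rewrite -(size_map half) -(size_iota 0 k); apply: uniq_leq_size.
  by rewrite map_inj_in_uniq.
by move=> _ /mapP[a sa ->]; rewrite mem_iota bnd.
Qed.

(* The homotopy [rho 0, ..., rho m] followed by the cone with apex [w]. *)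
Definition contraction (T U : Type) (rho : nat -> T -> U) (m : nat) (w : U)
    (z : seq (seq T)) : seq (seq U) :=
  flatten [seq flatten (map (prism (rho s) (rho s.+1)) z) | s <- iota 0 m] ++
  map (cons w) (map (map (rho m)) z).

(** The prisms telescope, and the cone fills the last image of [z]. *)
Lemma ev_contraction T U (rho : nat -> T -> U) m w z phi : mod2_cycle z ->
  ev (contraction rho m w z) (cobd phi) = ev z (phi \o map (rho 0)).
Proof.
move=> cz; rewrite ev_cat (ev_cone _ _ (mod2_cycle_map _ cz)) ev_map.
suff -> : ev (flatten [seq flatten (map (prism (rho s) (rho s.+1)) z) | s <- iota 0 m])
    (cobd phi) = ev z (phi \o map (rho m)) (+) ev z (phi \o map (rho 0)).
  by rewrite addbC addbA addbb.
elim: m => [|m IH]; first by rewrite ev_nil addbb.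
rewrite -addn1 iotaD map_cat flatten_cat ev_cat IH /= cats0 ev_homotopy // add0n addn1.
by rewrite addbC -addbA (addbA (ev z (phi \o map (rho m)))) addbb.
Qed.

(** * Fan cycles in the box complex *)

Definition simplex (G : sgraph) (s : seq (G * bool)) : Prop :=
  forall u v, (u, true) \in s -> (v, false) \in s -> adj u v.

Definition flip (T : Type) (x : T * bool) : T * bool := (x.1, ~~ x.2).

Lemma flipK T : involutive (@flip T).
Proof. by case=> x b; rewrite /flip /= negbK. Qed.

Definition label (T : Type) (f : T -> nat) (x : T * bool) : nat := (f x.1).*2 + x.2.

Definition proper_labelling (G : sgraph) (f : G -> nat) : Prop :=
  forall u v, adj u v -> f u <> f v.

Lemma half_label T (f : T -> nat) x : (label f x)./2 = f x.1.
Proof. by rewrite /label addnC half_bit_double. Qed.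

Lemma label_flip T (f : T -> nat) x : label f (flip x) = opp_label (label f x).
Proof.
rewrite /opp_label half_label /label /= oddD odd_double.
by case: x.2.
Qed.

Lemma simplex_flip (G : sgraph) (s : seq (G * bool)) :
  simplex s -> simplex (map (@flip G) s).
Proof.
move=> hs u v /mapP[[u' b] u's [-> eb]] /mapP[[v' b'] v's [-> eb']].
by case: b b' eb eb' u's v's => [] [] // _ _ u's v's; rewrite adj_sym; apply: hs.
Qed.

Lemma simplex_label_inj (G : sgraph) (f : G -> nat) (s : seq (G * bool)) :
  proper_labelling f -> simplex s -> {in map (label f) s &, injective half}.
Proof.
move=> pf hs _ _ /mapP[[u b] us ->] /mapP[[v b'] vs ->].
rewrite !half_label /label /= => e; rewrite e; congr (_ + nat_of_bool _).
case: b b' us vs => [] [] us vs //; first by case: (pf u v (hs _ _ us vs)).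
by case: (pf v u (hs _ _ vs us)).
Qed.

Lemma cobd_alt_label (G : sgraph) (f : G -> nat) (s : seq (G * bool)) :
  proper_labelling f -> simplex s ->
  cobd (alt \o map (label f)) s =
    alt (map (label f) s) (+) alt (map (label f) (map (@flip G) s)).
Proof.
move=> pf hs; rewrite -cobd_map cobd_alt; last exact: simplex_label_inj.
by rewrite -!map_comp; congr (_ (+) alt _); apply: eq_map => x /=; rewrite label_flip.
Qed.

(** [d] counts vertices, so the dimension is [d - 1]. The last clause is an odd count of alternating
    simplices, for all proper labellings of one cycle. *)
Definition fan_cycle (G : sgraph) (d : nat) (S : pred G) (z : seq (seq (G * bool))) :=
  [/\ forall s, s \in z -> [/\ simplex s, size s = d & {subset s <= [pred x | S x.1]}],
      mod2_cycle z,
      forall phi, ev z (phi \o map (@flip G)) = ev z phi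
    & forall f, proper_labelling f -> ev z (alt \o map (label f))].

Definition fan (G : sgraph) (d : nat) (S : pred G) : Prop := exists z, fan_cycle d S z.

Lemma fan0 (G : sgraph) (S : pred G) : fan 0 S.
Proof.
exists [:: [::]]; split=> [s|phi|phi|f pf]; rewrite /ev ?big_seq1 //.
by rewrite inE => /eqP->.
Qed.

Lemma fan_labels (G : sgraph) (S : pred G) d k (f : G -> nat) :
  fan d S -> proper_labelling f -> (forall v, f v < k) -> d <= k.
Proof.
case=> z [hz _ _ hf] pf fk; have [//|dk] := leqP d k.
have := hf f pf; rewrite (@eq_in_ev _ _ xpred0); first by rewrite /ev big1.
move=> s sz; have [ss sd _] := hz s sz; apply: contraTF dk => /= als.
rewrite -leqNgt -sd -(size_map (label f)); apply: alt_size als.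
  exact: simplex_label_inj.
by move=> _ /mapP[x _ ->]; rewrite half_label.
Qed.

Lemma fan_hom (G H : sgraph) (i : G -> H) (S : pred G) (S' : pred H) d :
  (forall u v, adj u v -> adj (i u) (i v)) -> (forall u, S u -> S' (i u)) ->
  fan d S -> fan d S'.
Proof.
move=> hi hS [z [hz cz fz pz]]; pose j (x : G * bool) := (i x.1, x.2).
exists (map (map j) z); split.
- move=> _ /mapP[s /hz[ss sd sS] ->]; rewrite size_map; split=> //.
    by move=> _ _ /mapP[[u b] us [-> /= eb]] /mapP[[v b'] vs [-> /= eb']]; subst; apply/hi/ss.
  by move=> _ /mapP[x /sS xS ->]; apply: hS.
- exact: mod2_cycle_map.
- move=> phi; rewrite !ev_map -[RHS]fz; apply: eq_ev => s /=.
  by rewrite -!map_comp.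
- move=> f pf; rewrite ev_map (@eq_ev _ _ (alt \o map (label (f \o i)))) ?pz //.
    by move=> u v uv; apply: pf; apply: hi.
  by move=> s /=; rewrite -map_comp.
Qed.

(** A prism mixes two consecutive times, whence adjacency is required for times differing by at most
    one. The apex is taken positive, so it only has to be adjacent to negative vertices. *)
Lemma fan_contraction (G : sgraph) (S S' : pred G) d m (rho : nat -> bool -> G -> G) w :
  (forall b u, S u -> rho 0 b u = u) ->
  (forall s b u, S u -> s <= m -> S' (rho s b u)) ->
  (forall s t u v, S u -> S v -> adj u v -> s <= t.+1 -> t <= s.+1 -> s <= m -> t <= m ->
     adj (rho s true u) (rho t false v)) ->
  S' w -> (forall v, S v -> adj w (rho m false v)) ->
  fan d S -> fan d.+1 S'.
Proof.
move=> r0 rS radj wS wadj [z [hz cz fz pz]].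
pose R s (x : G * bool) := (rho s x.2 x.1, x.2).
pose H := contraction R m (w, true) z.
have Rin s t x y : x \in z -> y \in map (R s) x ++ map (R t) x ->
    exists u q, [/\ (u, y.2) \in x, S u, q = s \/ q = t & y.1 = rho q y.2 u].
  move=> /hz[_ _ xS]; rewrite mem_cat => /orP[] /mapP[[u b] ux ->];
    have Su := xS _ ux.
    by exists u, s; split=> //; left.
  by exists u, t; split=> //; right.
have Rs x y s t : x \in z -> {subset y <= map (R s) x ++ map (R t) x} ->
    s <= m -> t <= m -> s <= t.+1 -> t <= s.+1 ->
    simplex y /\ {subset y <= [pred x | S' x.1]}.
  move=> xz ysub sm tm st ts; have [xs _ _] := hz x xz; split.
    move=> u v /ysub/(Rin _ _ _ _ xz)[u' [q [u'x Su' eq /= ->]]].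
    move=> /ysub/(Rin _ _ _ _ xz)[v' [q' [v'x Sv' eq' /= ->]]].
    by apply: radj => //; [exact: xs| | | |]; lia.
  move=> u /ysub/(Rin _ _ _ _ xz)[u' [q [u'x Su' eq e]]].
  by rewrite inE e; apply: rS => //; case: eq => ->.
have hH s : s \in H -> [/\ simplex s, size s = d.+1 & {subset s <= [pred x | S' x.1]}].
  rewrite mem_cat => /orP[].
    case/flatten_mapP=> q; rewrite mem_iota add0n => qm /flatten_mapP[x xz /prismP[sz sub]].
    have [_ sd _] := hz x xz; rewrite sz sd.
    by have [] := Rs x s q q.+1 xz sub (ltnW qm) qm; rewrite // leqW // leqW.
  case/mapP=> _ /mapP[x xz ->] ->; have [_ sd xS] := hz x xz.
  have sub : {subset map (R m) x <= map (R m) x ++ map (R m) x}.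
    by move=> y yx; rewrite mem_cat yx.
  have [sx yS] := Rs x _ m m xz sub (leqnn m) (leqnn m) (leqnSn m) (leqnSn m).
  split; rewrite /= ?size_map ?sd //.
    move=> u v; rewrite !inE => /orP[/eqP[->]|ux] /orP[/eqP[]//|vx].
      by have /mapP[[v' b] /xS vS' [-> /= <-]] := vx; exact: wadj.
    exact: sx.
  by move=> y; rewrite inE => /orP[/eqP->|/yS].
have evH phi : ev H (cobd phi) = ev z phi.
  rewrite ev_contraction //; apply: eq_in_ev => s /hz[_ _ sS] /=; congr phi.
  rewrite -[RHS]map_id; apply/eq_in_map => -[u b] /sS uS.
  by rewrite /R /= r0.
(* The suspension: [H] and its mirror image have the same boundary because [z] is invariant. *)
exists (H ++ map (map (@flip G)) H); split.
- move=> s; rewrite mem_cat => /orP[/hH //|/mapP[x /hH[xs xd xS] ->]].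
  split; rewrite ?size_map //; first exact: simplex_flip.
  by move=> _ /mapP[y /xS yS ->].
- move=> phi; rewrite ev_cat ev_map (eq_ev _ (cobd_map _ _)) !evH.
  by rewrite fz addbb.
- move=> phi; rewrite !(ev_cat H) !(ev_map _ H).
  rewrite [X in _ (+) X](@eq_ev _ _ phi) => [|s /=]; first exact: addbC.
  by rewrite (mapK (@flipK G)).
(* The counts on the two halves add up to the coboundary of [alt] on [H], that is, to the count on
   [z]. *)
- move=> f pf; rewrite (ev_cat H) (ev_map _ H) -ev_add.
  suff -> : ev H (fun s => (alt \o map (label f)) s (+)
      ((alt \o map (label f)) \o map (@flip G)) s) = ev z (alt \o map (label f)).
    exact: pz.
  by rewrite -evH; apply: eq_in_ev => s /hH[ss _ _] /=; rewrite cobd_alt_label.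
Qed.

(** * The tower and its suspensions *)

Definition compat (T : Type) (e : rel T) (a b : option T) : bool :=
  if a is Some u then if b is Some v then e u v else true else true.

Lemma compat_sym T (e : rel T) : symmetric e -> symmetric (compat e).
Proof. by move=> es [u|] [v|] //=. Qed.

Definition tower_vertex (G : sgraph) (c q : nat) : finType :=
  (G + 'I_c + G * 'I_c * 'I_q.+1)%type.

Section Tower.
Variables (G : sgraph) (c q : nat).
Implicit Types x y : tower_vertex G c q.

Definition level x : nat :=
  match x with inl (inl _) => 0 | inl (inr _) => q.+2 | inr (_, _, l) => l.+1 end.

Definition toG x : option G :=
  match x with inl (inl v) => Some v | inl (inr _) => None | inr (v, _, _) => Some v end.

Definition toK x : option 'I_c :=
  match x with inl (inl _) => None | inl (inr i) => Some i | inr (_, i, _) => Some i end.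

Definition tower_adj x y : bool :=
  [&& level x <= (level y).+1, level y <= (level x).+1,
      compat (@adj G) (toG x) (toG y) & compat (fun i j => i != j) (toK x) (toK y)].

Lemma tower_adj_sym : symmetric tower_adj.
Proof.
move=> x y; rewrite /tower_adj (compat_sym (@adj_sym G)) andbCA; congr [&& _, _, _ & _].
by apply: compat_sym => i j; rewrite eq_sym.
Qed.

Lemma tower_adj_irrefl : irreflexive tower_adj.
Proof.
by case=> [[v|i]|[[v i] l]]; rewrite /tower_adj /= ?adj_irrefl ?eqxx ?andbF.
Qed.

Definition tower : sgraph := SGraph tower_adj_sym tower_adj_irrefl.

Lemma card_tower : #|tower| = #|G| + c + #|G| * c * q.+1.
Proof. by rewrite !card_sum !card_prod !card_ord. Qed.

Definition place (v : G) (k : nat) (i : 'I_c) : tower :=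
  if k is k'.+1 then inr (v, i, inord k') else inl (inl v).

Lemma level_place v k i : k <= q.+1 -> level (place v k i) = k.
Proof. by case: k => //= k kq; rewrite inordK. Qed.

Lemma toG_place v k i : toG (place v k i) = Some v.
Proof. by case: k. Qed.

Lemma toK_place v k i : toK (place v k i) = if k is 0 then None else Some i.
Proof. by case: k. Qed.

Lemma level_max x : level x <= q.+2.
Proof. by case: x => [[v|i]|[[v i] l]] //=; apply: ltnW; apply: (ltn_ord l). Qed.

Lemma level_toG x : level x <= q.+1 -> exists v, toG x = Some v.
Proof. by case: x => [[v|i]|[[v i] l]] /=; [exists v | rewrite ltnn | exists v]. Qed.

Lemma level_toK x : 0 < level x -> exists i, toK x = Some i.
Proof. by case: x => [[v|i]|[[v i] l]] //=; exists i. Qed.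

(** Leg [i] consists of the vertices over [i] in K_c; a stage is the base together with the legs
    below [j]. *)
Definition stage (j : nat) : pred tower :=
  fun x => if toK x is Some i then i < j else true.

(* The contraction to apex [j]: positive vertices change to leg [j] while they
   rise, negative vertices rise in their own leg, those of the base in leg [i0].
   The positive ones move first, so that [toK] never clashes when a negative
   base vertex enters leg [i0]. *)
Definition raise_plus (j : 'I_c) (s : nat) (x : tower) : tower :=
  if toG x is Some v then
    if (0 < s) && (level x <= uphalf s) then place v (uphalf s) j else x
  else x.

Definition raise_minus (i0 : 'I_c) (s : nat) (x : tower) : tower :=
  match x with
  | inl (inl v) => place v s./2 i0
  | inl (inr _) => x
  | inr (v, i, l) => place v (maxn l.+1 s./2) i
  end.

Lemma toG_raise_plus j s x : toG (raise_plus j s x) = toG x.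
Proof.
rewrite /raise_plus; case e: (toG x) => [v|] //; case: ifP => // _.
exact: toG_place.
Qed.

Lemma toG_raise_minus i s x : toG (raise_minus i s x) = toG x.
Proof. by case: x => [[v|k]|[[v k] l]] //=; apply: toG_place. Qed.

Lemma level_raise_plus j s x : uphalf s <= q.+1 ->
  level (raise_plus j s x) = maxn (level x) (uphalf s).
Proof.
move=> sq; rewrite /raise_plus; case e: (toG x) => [v|].
  case: ifP => [|] h; first by rewrite level_place //; lia.
  by case: s sq h => [|s] //=; lia.
by case: x e => [[w|k]|[[w k] l]] //= _; lia.
Qed.

Lemma level_raise_minus i s x : s./2 <= q.+1 ->
  level (raise_minus i s x) = maxn (level x) s./2.
Proof.
move=> sq; case: x => [[w|k]|[[w k] l]]; rewrite /raise_minus.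
- by rewrite level_place // max0n.
- by rewrite /level; lia.
- by have := ltn_ord l => lq; rewrite level_place //; lia.
Qed.

Lemma toK_raise_plus j s x :
  toK (raise_plus j s x) = toK x \/ toK (raise_plus j s x) = Some j.
Proof.
rewrite /raise_plus; case: (toG x) => [v|]; last by left.
case: ifP => [/andP[s0 _]|_]; last by left.
by right; rewrite toK_place; case: (uphalf s) (uphalf_gt0 s) => //; rewrite s0.
Qed.

Lemma toK_raise_minus i s x : toK (raise_minus i s x) = toK x \/
  [/\ toK (raise_minus i s x) = Some i, level x = 0 & 1 < s].
Proof.
case: x => [[w|k]|[[w k] l]] /=.
- rewrite toK_place; case e: s./2 => [|k]; [by left|right; split=> //].
  by case: s e => [|[|s]].
- by left.
- by left; rewrite toK_place; case e: (maxn _ _) => //; lia.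
Qed.

Lemma fan_stage (j i0 : 'I_c) d : i0 < j ->
  fan d (stage j) -> fan d.+1 (stage j.+1).
Proof.
move=> i0j; pose rho s (b : bool) := if b then raise_plus j s else raise_minus i0 s.
(* After [(q.+1).*2] half-steps every vertex has level at least [q.+1], within one of the apex. *)
apply: (@fan_contraction tower _ _ d (q.+1).*2 rho (inl (inr j))).
- case=> [] u _; rewrite /rho /raise_plus /raise_minus /=; first by case: (toG u).
  case: u => [[v|i]|[[v i] l]] //=.
  by congr (inr (_, _, _)); apply: val_inj; rewrite /= inordK.
- move=> s b u; rewrite /stage /rho => Su _; case: b.
    case: (toK_raise_plus j s u) => ->; last exact: leqnn.
    by case: (toK u) Su => // i /ltnW.
  case: (toK_raise_minus i0 s u) => [->|[-> _ _]]; last exact: leqW.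
  by case: (toK u) Su => // i /ltnW.
- move=> s t u v Su Sv /and4P[l1 l2 cG cK] st ts sm tm; rewrite /rho.
  have sq : uphalf s <= q.+1 by lia.
  have tq : t./2 <= q.+1 by lia.
  apply/and4P; split.
  + by rewrite level_raise_plus // level_raise_minus //; lia.
  + by rewrite level_raise_plus // level_raise_minus //; lia.
  + by rewrite toG_raise_plus toG_raise_minus.
  case: (toK_raise_minus i0 t v) => [ev|[ev lv t1]].
    case: (toK_raise_plus j s u) => eu; rewrite eu ev //=.
    by move: Sv; rewrite /stage; case: (toK v) => // i ij; rewrite neq_ltn ij orbT.
  (* A negative base vertex enters leg [i0] only when [t >= 2]; then [s >= 1], and [u], of level at
     most 1, is already in leg [j]. *)
  suff -> : toK (raise_plus j s u) = Some j by rewrite ev /= neq_ltn i0j orbT.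
  have [w ew] : exists w, toG u = Some w by apply: level_toG; lia.
  rewrite /raise_plus ew ifT ?toK_place; last by lia.
  by case: (uphalf s) (uphalf_gt0 s) => //; lia.
- by rewrite /stage /=.
- move=> v Sv; apply/and4P; rewrite /rho level_raise_minus ?doubleK //=.
  split=> //; first by lia.
  + by have := level_max v; lia.
  case: (toK_raise_minus i0 (q.+1).*2 v) => [->|[-> _ _]].
    by move: Sv; rewrite /stage; case: (toK v) => // i ij; rewrite neq_ltn ij orbT.
  by rewrite neq_ltn i0j orbT.
Qed.

Lemma fan_tower d : 0 < c -> fan d (@predT G) -> fan (d + c.-1) (@predT tower).
Proof.
move=> c0 fG; suff: fan (d + c.-1) (stage c).
  by apply: (@fan_hom tower tower id).
(* Leg 0 gets no suspension: it is the [i0] that receives the negative base vertices. *)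
have H j : j < c -> fan (d + j) (stage j.+1).
  elim: j => [|j IH] jc.
    rewrite addn0; apply: (@fan_hom G tower (fun v => inl (inl v))) fG => //.
    by move=> u v uv; rewrite /= /tower_adj /= uv.
  rewrite addnS; apply: (@fan_stage (Ordinal jc) (Ordinal c0)) => //=.
  by apply: IH; apply: ltnW.
by rewrite -{2}(prednK c0); apply: H; rewrite prednK.
Qed.
End Tower.

(** * Balls and local colourings *)

Definition near (G : sgraph) (k : nat) (x v : G) : Prop :=
  exists p, [/\ path (@adj G) x p, last x p = v & size p <= k].

Definition locally_colorable (r c : nat) (G : sgraph) : Prop :=
  forall v : G, exists f : G -> 'I_c,
    forall x y, near r x v -> near r y v -> adj x y -> f x != f y.

Lemma ball_near (G : sgraph) r (x v : G) : x \in ball r v -> near r x v.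
Proof.
rewrite inE /dist; case: {-}_ / idP => // xv; case: ex_minnP => k.
case/existsP=> p /andP[xp /eqP pv] _ kr.
by exists p; rewrite size_tuple.
Qed.

Lemma chromatic_number_le (G : sgraph) c (f : G -> 'I_c) :
  (forall x y, adj x y -> f x != f y) -> chromatic_number G <= c.
Proof.
move=> hf; rewrite /chromatic_number; case: ex_minnP => k _; apply.
apply/existsP; exists [ffun x => f x]; apply/forallP => x; apply/forallP => y.
by apply/implyP => /hf; rewrite !ffunE.
Qed.

Lemma local_chromatic_number_le r c (G : sgraph) :
  locally_colorable r c G -> local_chromatic_number r G <= c.
Proof.
move=> lc; apply/bigmax_leqP => v _; have [f hf] := lc v.
apply: (@chromatic_number_le _ _ (fun x : induced (ball r v) => f (val x))).
by move=> x y; apply: hf; apply: ball_near; apply: valP.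
Qed.

Lemma chromatic_number_ge (G : sgraph) d (S : pred G) : fan d S -> d <= chromatic_number G.
Proof.
move=> fd; rewrite /chromatic_number; case: ex_minnP => k /existsP[f /forallP pf] _.
apply: (@fan_labels _ _ _ _ (fun v => nat_of_ord (f v)) fd) => [u v uv|v]; last exact: ltn_ord.
by move/val_inj/eqP; apply/negP; move/forallP/(_ v)/implyP: (pf u) => ->.
Qed.

Lemma near_tower_level (G : sgraph) c q k (x v : tower G c q) :
  near k x v -> level x <= level v + k /\ level v <= level x + k.
Proof.
case=> p [xp pv pk]; elim: p x k xp pv pk => [|y p IH] x k /=; first by move=> _ ->; lia.
case/andP=> /and4P[l1 l2 _ _] yp pv; case: k => // k pk.
by have [] := IH y k yp pv pk; lia.
Qed.

(** The walk never reaches the top level [q.+2], so [toG] is defined all along it. *)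
Lemma near_tower_project (G : sgraph) c q k (x v : tower G c q) a b :
  near k x v -> level v + k <= q.+1 -> toG x = Some a -> toG v = Some b -> near k a b.
Proof.
case=> p [xp pv pk]; elim: p x k a xp pv pk => [|y p IH] x k a /=.
  by move=> _ -> _ _ -> [->]; exists [::].
case/andP=> /and4P[_ _ cG _] yp pv; case: k => // k pk vk xa vb.
have [l _] : level y <= level v + k /\ level v <= level y + k.
  by apply: near_tower_level; exists p.
have [e ye] : exists e, toG y = Some e by apply: level_toG; lia.
have [|s [es sb sk]] := IH y k e yp pv pk _ ye vb; first by lia.
by exists (e :: s); split=> //=; rewrite es andbT; move: cG; rewrite xa ye.
Qed.

Lemma locally_colorable_tower r c q (G : sgraph) : 0 < c -> q.+1 = 2 * r ->
  locally_colorable r c G -> locally_colorable r c (tower G c q).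
Proof.
move=> c0 qr lc v; have [vr|vr] := leqP (level v) r.
  have [b vb] : exists b, toG v = Some b by apply: level_toG; lia.
  have [f hf] := lc b.
  (* The default colour [Ordinal c0] is only used outside the ball, which stays at levels up to
     [2 * r = q.+1]. *)
  exists (fun x => if toG x is Some a then f a else Ordinal c0) => x y nx ny xy.
  have [lx _] := near_tower_level nx; have [ly _] := near_tower_level ny.
  have [a xa] : exists a, toG x = Some a by apply: level_toG; lia.
  have [e ye] : exists e, toG y = Some e by apply: level_toG; lia.
  have vq : level v + r <= (q.+1) by lia.
  rewrite xa ye; apply: hf.
  - exact: near_tower_project nx vq xa vb.
  - exact: near_tower_project ny vq ye vb.
  - by case/and4P: xy => _ _; rewrite xa ye.
exists (fun x => if toK x is Some a then a else Ordinal c0) => x y nx ny xy.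
have [_ lx] := near_tower_level nx; have [_ ly] := near_tower_level ny.
have [a xa] : exists a, toK x = Some a by apply: level_toK; lia.
have [e ye] : exists e, toK y = Some e by apply: level_toK; lia.
by case/and4P: xy => _ _ _; rewrite xa ye.
Qed.

(** * Complete graphs and the iteration *)

Definition neq_rel (T : eqType) : rel T := fun x y => x != y.

Lemma neq_rel_sym (T : eqType) : symmetric (@neq_rel T).
Proof. by move=> x y; rewrite /neq_rel eq_sym. Qed.

Lemma neq_rel_irrefl (T : eqType) : irreflexive (@neq_rel T).
Proof. by move=> x; rewrite /neq_rel eqxx. Qed.

Definition complete (c : nat) : sgraph :=
  SGraph (@neq_rel_sym 'I_c) (@neq_rel_irrefl 'I_c).

(** Each vertex is adjacent to all earlier ones, so a cone with no homotopy ([m = 0]) suffices; the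
    cycle is the boundary of a cross-polytope. *)
Lemma fan_complete c : fan c (@predT (complete c)).
Proof.
suff H j : j <= c -> fan j (fun i : complete c => (i : 'I_c) < j).
  by apply: (@fan_hom (complete c) (complete c) id) (H c (leqnn c)).
elim: j => [|j IH] jc; first exact: fan0.
apply: (@fan_contraction (complete c) _ _ j 0 (fun _ _ => id) (Ordinal jc)) (IH (ltnW jc)) => //=.
- by move=> _ _ u uj _; apply: ltnW.
- by move=> v vj; rewrite /neq_rel -val_eqE /= neq_ltn vj orbT.
Qed.

(** Each tower multiplies [#|G| * (2 * r) + 1] by [2 * r * c + 1] and raises the Fan bound by
    [c - 1]. *)
Lemma exists_tower c r n : 0 < c -> 0 < r ->
  exists G : sgraph, [/\ locally_colorable r c G, fan (n.+1 * (c - 1) + 1) (@predT G)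
    & #|G| * (2 * r) + 1 = (2 * r * c + 1) ^ n.+1].
Proof.
move=> c0 r0; elim: n => [|n [G [lG fG cG]]].
  exists (complete c); split.
  - by move=> v; exists id.
  - by rewrite mul1n subnK //; apply: fan_complete.
  - by rewrite card_ord expn1 mulnC.
have qr : (2 * r).-1.+1 = 2 * r by rewrite prednK //; lia.
exists (tower G c (2 * r).-1); split.
- exact: locally_colorable_tower.
- suff -> : n.+2 * (c - 1) + 1 = n.+1 * (c - 1) + 1 + c.-1 by apply: fan_tower.
  by rewrite (mulSn n.+1) subn1; lia.
- by rewrite card_tower qr expnS -cG; lia.
Qed.

Theorem theorem2 (c r n : nat) (hc : 3 <= c) (hr : 0 < r) (hn : 0 < n) :
  exists G : sgraph,
    [/\ local_chromatic_number r G <= c,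
        n * (c - 1) + 1 <= chromatic_number G
      & (#|G|%:R = ((2 * r * c + 1)%N%:R ^+ n - 1) / (2 * r)%N%:R :> rat)%R].
Proof.
case: n hn => // n _; have [|G [lG fG cG]] := @exists_tower c r n _ hr.
  exact: ltn_trans hc.
exists G; split; [exact: local_chromatic_number_le|exact: chromatic_number_ge fG|].
rewrite -natrX -cG natrD addrK natrM mulfK //.
by rewrite pnatr_eq0 muln_eq0 -lt0n hr.
Qed.
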